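(* Let $\mathrm{B}\Gamma$ be a finite connected bipartite graph with bipartition $(V,W)$. Then there exists a finite-dimensional indecomposable semisimple Leibniz algebra $L$ over $\mathbb{C}$ whose corresponding bipartite graph is (isomorphic, as a bipartite graph, to) $\mathrm{B}\Gamma$.
   Context: A Leibniz algebra is a vector space $L$ with a bilinear bracket satisfying $[[x,y],z]=[[x,z],y]+[x,[y,z]]$. The subspace $I=\mathrm{Span}\langle [x,x]\mid x\in L\rangle$ is an ideal with $[L,I]=0$, $\mathfrak{g}_L=L/I$ is a Lie algebra, and $L$ is semisimple if $\mathfrak{g}_L$ is a semisimple Lie algebra. A finite-dimensional semisimple $L$ then decomposes as $L=(\oplus_{i=1}^m\mathfrak{g}_i)\ltimes(\oplus_{k=1}^n I_k)$, where the $\mathfrak{g}_i$ are simple Lie subalgebras whose direct sum is a subalgebra complementary to $I$, and $I=\oplus_k I_k$ is a decomposition into simple modules for the right action $i.g=[i,g]$. The corresponding bipartite graph of $L$ has bipartition $(\{I_1,\dots,I_n\},\{\mathfrak{g}_1,\dots,\mathfrak{g}_m\})$, with $I_k\mathfrak{g}_i$ an edge if and only if $[I_k,\mathfrak{g}_i]=I_k$ (otherwise $[I_k,\mathfrak{g}_i]=\{0\}$). An algebra is indecomposable if it is not a direct sum of two proper nonzero ideals.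
   Formalization: The formal theorem assumes W is nonempty; this excludes only the one-vertex graph with its vertex in V, for which no such L exists (there L = I, so [L,L] = [L,I] = 0 and I = 0). *)

(* Defs.v *)
From HB Require Import structures.
From mathcomp Require Import all_boot all_order all_algebra.
From mathcomp Require Import complex.
From Stdlib Require Import Reals.
From mathcomp Require Import Rstruct.

Set Implicit Arguments.
Unset Strict Implicit.
Unset Printing Implicit Defensive.

Import GRing.Theory.
Local Open Scope ring_scope.

Definition Cfield : fieldType := (Rdefinitions.R)[i].

Section Leibniz.
Variables (F : fieldType) (V : vectType F) (br : V -> V -> V).

Definition bilinear_br : Prop :=
  forall (a : F) (x y z : V),
    br (a *: x + y) z = a *: br x z + br y z /\
    br z (a *: x + y) = a *: br z x + br z y.

Definition leibniz_identity : Prop :=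
  forall x y z : V, br (br x y) z = br (br x z) y + br x (br y z).

Definition sub_br (U W X : {vspace V}) : Prop :=
  forall u w, u \in U -> w \in W -> br u w \in X.

(* [U, W] = span of all brackets [u,w] (u in U, w in W); for a bilinear
   bracket this is the span of the brackets of basis vectors *)
Definition brsp (U W : {vspace V}) : {vspace V} :=
  (<< [seq br u w | u <- (vbasis U : seq V), w <- (vbasis W : seq V)] >>)%VS.

Definition is_Ispace (I : {vspace V}) : Prop :=
  (forall x, br x x \in I) /\
  (forall U : {vspace V}, (forall x, br x x \in U) -> (I <= U)%VS).

(* Ideals of g_L = L/I correspond to subspaces J >= I with [J, L] <= J *)
Definition lie_ideal_mod (I J : {vspace V}) : Prop :=
  (I <= J)%VS /\ sub_br J fullv J.

(* derived series of J/I computed inside L: D_0 = J, D_{k+1} = [D_k,D_k] + I *)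
Definition derived_mod (I J : {vspace V}) (k : nat) : {vspace V} :=
  iter k (fun D => (brsp D D + I)%VS) J.

Definition solvable_mod (I J : {vspace V}) : Prop :=
  exists k, (derived_mod I J k <= I)%VS.

Definition semisimple_mod (I : {vspace V}) : Prop :=
  forall J, lie_ideal_mod I J -> solvable_mod I J -> J = I.

Definition semisimple_leibniz : Prop :=
  forall I, is_Ispace I -> semisimple_mod I.

Definition ideal (A : {vspace V}) : Prop :=
  sub_br A fullv A /\ sub_br fullv A A.

Definition indecomposable : Prop :=
  ~ exists A B : {vspace V},
      ideal A /\ ideal B /\ A != 0%VS /\ B != 0%VS /\ A != fullv /\
      B != fullv /\ (A + B)%VS = fullv /\ (A :&: B)%VS = 0%VS.

Definition simple_lie_subalg (g : {vspace V}) : Prop :=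
  [/\ sub_br g g g,
      (forall x, x \in g -> br x x = 0),
      (exists x y, [/\ x \in g, y \in g & br x y != 0]) &
      (forall J : {vspace V}, (J <= g)%VS -> sub_br J g J ->
          J = 0%VS \/ J = g)].

Definition simple_module (S U : {vspace V}) : Prop :=
  [/\ U != 0%VS, sub_br U S U &
      (forall X : {vspace V}, (X <= U)%VS -> sub_br X S X ->
          X = 0%VS \/ X = U)].

Definition is_decomposition (I : {vspace V}) (m n : nat)
    (g : 'I_m -> {vspace V}) (Ik : 'I_n -> {vspace V}) : Prop :=
  let S := (\sum_(i < m) g i)%VS in
  (forall i, simple_lie_subalg (g i)) /\
  directv (\sum_(i < m) g i)%VS /\
  (forall i j, i != j -> sub_br (g i) (g j) 0%VS) /\
  sub_br S S S /\
  (S + I)%VS = fullv /\ (S :&: I)%VS = 0%VS /\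
  directv (\sum_(k < n) Ik k)%VS /\
  (\sum_(k < n) Ik k)%VS = I /\
  (forall k, simple_module S (Ik k)).

Definition decomp_edge m n (g : 'I_m -> {vspace V}) (Ik : 'I_n -> {vspace V})
    (k : 'I_n) (i : 'I_m) : bool :=
  brsp (Ik k) (g i) == Ik k.

End Leibniz.

Definition bip_rel (Vb Wb : finType) (E : Vb -> Wb -> bool) : rel (Vb + Wb)%type :=
  fun x y => match x, y with
             | inl v, inr w => E v w
             | inr w, inl v => E v w
             | _, _ => false
             end.

Definition bip_connected (Vb Wb : finType) (E : Vb -> Wb -> bool) : Prop :=
  (0 < #|{: (Vb + Wb)%type}|)%nat /\ forall x y, connect (bip_rel E) x y.

(* isomorphism of bipartite graphs preserving the bipartition:
   the I_k correspond to Vb, the g_i to Wb *)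
Definition bip_iso (Vb Wb : finType) (E : Vb -> Wb -> bool) m n
    (edge : 'I_n -> 'I_m -> bool) : Prop :=
  exists (f : 'I_n -> Vb) (h : 'I_m -> Wb),
    [/\ bijective f, bijective h & forall k i, E (f k) (h i) = edge k i].

(* Main.v *)
Require Import Defs.
From mathcomp Require Import all_boot all_order all_algebra.
From mathcomp Require Import complex Rstruct ring.
From Stdlib Require Import FunctionalExtensionality.
Local Open Scope ring_scope.

Set Implicit Arguments.
Unset Strict Implicit.
Unset Printing Implicit Defensive.
Import GRing.Theory.

(** Let V(l) be the irreducible sl_2-module of dimension l + 1. Put a copy of
    sl_2 on every w in Wb, and on every v in Vb the tensor product over the
    neighbours w of v of modules V(rank v + 3), the copy of sl_2 at w acting on
    its own factor. As a right module over S0, the sum of the copies of sl_2,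
    the resulting algebra L is a direct sum of "blocks" indexed by Vb + Wb:
    the modules just described, and the copies of sl_2 themselves, which are
    V(2) at w. All blocks have different highest weights, so every nonzero
    right ideal of L contains a block: raise a vector to a combination of
    highest weight vectors, isolate one of them with the Cartan elements, and
    lower it again. This gives simplicity of all blocks, semisimplicity and,
    with connectedness, indecomposability. It also gives uniqueness of the
    decomposition: the I_k have to be blocks, and each g_i is a block modulo
    I, which is all that matters because [L, I] = 0. *)

(** * The action of sl_2 on V(l) in coordinates *)

Section LineOperator.
Variable F : fieldType.
Implicit Types (c d f : nat -> F) (l j : nat).

(* With e u_j = j u_(j-1), h u_j = (l - 2j) u_j, f u_j = (l - j) u_(j+1) on
   V(l) = <u_0, ..., u_l>, this is the coefficient at u_j of
   (- 2 c_0 e + c_1 h + 2 c_2 f) (sum_i f_i u_i). The scalars -2, 1, 2 are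
   chosen so that V(2) with the product (x, y) |-> (y acting on x) is sl_2. *)
Definition line_op l c f j : F :=
  - (2 * c 0 * j.+1%:R * f j.+1) + c 1 * (l%:R - 2 * j%:R) * f j
  + 2 * c 2 * (if j is i.+1 then (l%:R - i%:R) * f i else 0).

(** The sl_2 relations are polynomial identities in [j] and [l], so [f] may be any sequence. On the
    right only the entries 0, 1, 2 of [line_op 2 d c] act, and entry 2 involves [c 3]. *)
Lemma line_op_lie l c d f j : c 3 = 0 ->
  line_op l d (line_op l c f) j - line_op l c (line_op l d f) j =
  line_op l (line_op 2 d c) f j.
Proof.
by move=> c3; case: j => [|[|j]]; rewrite /line_op /= c3; ring.
Qed.

Lemma line_opPr l c a f g j :
  line_op l c (fun i => a * f i + g i) j =
  a * line_op l c f j + line_op l c g j.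
Proof. by case: j => [|j]; rewrite /line_op; ring. Qed.

Lemma line_op0r l c f j : (forall i, f i = 0) -> line_op l c f j = 0.
Proof. by move=> f0; case: j => [|j]; rewrite /line_op !f0; ring. Qed.

Lemma line_op_sum l c (I : Type) (r : seq I) (f : I -> nat -> F) j :
  line_op l c (fun i => \sum_(k <- r) f k i) j =
  \sum_(k <- r) line_op l c (f k) j.
Proof.
elim: r => [|k r IHr]; first by rewrite big_nil line_op0r // => i; rewrite big_nil.
rewrite big_cons -IHr -[line_op l c (f k) j]mul1r -line_opPr.
by congr line_op; apply: functional_extensionality => i; rewrite big_cons mul1r.
Qed.

Lemma line_opPl l c d a f j :
  line_op l (fun i => a * c i + d i) f j =
  a * line_op l c f j + line_op l d f j.
Proof. by case: j => [|j]; rewrite /line_op; ring. Qed.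

Lemma line_op0l l c f j : (forall i, c i = 0) -> line_op l c f j = 0.
Proof. by move=> c0; case: j => [|j]; rewrite /line_op !c0; ring. Qed.

Lemma line_op_comm l l' c d (f : nat -> nat -> F) j k :
  line_op l c (fun i => line_op l' d (f i) k) j =
  line_op l' d (fun i => line_op l c (f^~ i) j) k.
Proof. by case: j => [|j]; case: k => [|k]; rewrite /line_op; ring. Qed.

(** The coefficient passing from u_l to u_(l+1) is l - l = 0, so V(l) is stable inside the space of
    all sequences. *)
Lemma line_op_supp l c f j :
  (forall i, (l < i)%N -> f i = 0) -> (l < j)%N -> line_op l c f j = 0.
Proof.
move=> f0; rewrite /line_op; case: j => // j; rewrite ltnS leq_eqVlt.
move=> /orP[/eqP <-|lj].
  by rewrite (f0 l.+1) // (f0 l.+2) // subrr mul0r !mulr0 oppr0 !addr0.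
have lj1 := ltn_trans lj (ltnSn j); have lj2 := ltn_trans lj1 (ltnSn _).
by rewrite !f0 // !mulr0 oppr0 !addr0.
Qed.

Lemma line_op_alt c j :
  (forall i, (2 < i)%N -> c i = 0) -> line_op 2 c c j = 0.
Proof.
move=> c2; case: (ltnP 2 j) => [|j2]; first exact: line_op_supp.
by case: j j2 => [|[|[|//]]] _; rewrite /line_op /= ?(c2 3) //; ring.
Qed.

Lemma line_op0 c f j :
  (forall i, (0 < i)%N -> f i = 0) -> line_op 0 c f j = 0.
Proof.
move=> f0; case: j => [|j]; last exact: line_op_supp.
by rewrite /line_op f0 // !mulr0 subrr mulr0 mul0r oppr0 !addr0.
Qed.

End LineOperator.

(** * Row vectors with coordinates labelled by a list *)

Section Coordinates.
Variables (F : fieldType) (K : eqType) (s : seq K).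
Hypothesis uniq_s : uniq s.

(** For [t] outside [s] the index is [size s], [insub] fails, and the coordinate is 0. *)
Definition cf (x : 'rV[F]_(size s)) (t : K) : F :=
  if insub (index t s) is Some i then x 0 i else 0.

Definition vec_of_fun (f : K -> F) : 'rV[F]_(size s) := \row_i f (tnth (in_tuple s) i).

Definition unit_vec (t : K) : 'rV[F]_(size s) := vec_of_fun (fun t' => (t' == t)%:R).

Lemma cf_vec_of_fun f t : cf (vec_of_fun f) t = if t \in s then f t else 0.
Proof.
rewrite /cf -index_mem; case: insubP => [i -> it|/negPf -> //].
by rewrite mxE (tnth_nth t) /= it nth_index // -index_mem -it ltn_ord.
Qed.

Lemma cf_out x t : t \notin s -> cf x t = 0.
Proof. by rewrite /cf -index_mem; case: insubP => // i ->. Qed.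

Lemma cf_inj x y : cf x =1 cf y -> x = y.
Proof.
move=> xy; apply/rowP => i; have := xy (tnth (in_tuple s) i).
rewrite /cf (tnth_nth (tnth (in_tuple s) i)) index_uniq //.
by case: insubP => [j _ /ord_inj ->|]; rewrite ?ltn_ord.
Qed.

Lemma cfP a x y t : cf (a *: x + y) t = a * cf x t + cf y t.
Proof. by rewrite /cf; case: insub => [i|]; rewrite ?mxE // mulr0 addr0. Qed.

Lemma cf0 t : cf 0 t = 0.
Proof. by rewrite /cf; case: insub => [i|]; rewrite ?mxE. Qed.

Lemma cfD x y t : cf (x + y) t = cf x t + cf y t.
Proof. by have := cfP 1 x y t; rewrite scale1r mul1r. Qed.

Lemma cfZ a x t : cf (a *: x) t = a * cf x t.
Proof. by have := cfP a x 0 t; rewrite cf0 !addr0. Qed.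

Lemma cf_sum I (r : seq I) (Q : pred I) f t :
  cf (\sum_(i <- r | Q i) f i) t = \sum_(i <- r | Q i) cf (f i) t.
Proof. by apply: (big_morph (cf^~ t)) => [x y|]; rewrite ?cfD ?cf0. Qed.

Lemma cf_unit t t' : cf (unit_vec t) t' = ((t' \in s) && (t' == t))%:R.
Proof. by rewrite cf_vec_of_fun; case: ifP. Qed.

Lemma cf_expand x : x = \sum_(t <- s) cf x t *: unit_vec t.
Proof.
apply: cf_inj => t; rewrite cf_sum.
have [ts|nts] := boolP (t \in s).
  rewrite (bigD1_seq t) //= cfZ cf_unit ts eqxx mulr1 big1 ?addr0 // => t' ne.
  by rewrite cfZ cf_unit eq_sym (negPf ne) andbF mulr0.
by rewrite cf_out // big1 // => t' _; rewrite cfZ cf_unit (negPf nts) mulr0.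
Qed.

Lemma cf_eq0P x : reflect (exists t, cf x t != 0) (x != 0).
Proof.
apply: (iffP idP) => [nz|[t]]; last by apply: contraNneq => ->; rewrite cf0.
have [/hasP[t _ tP]|/hasPn none] := boolP (has (fun t => cf x t != 0) s).
  by exists t.
case/eqP: nz; rewrite [x]cf_expand big_seq big1 // => t /none.
by rewrite negbK => /eqP ->; rewrite scale0r.
Qed.

End Coordinates.

(** * Bilinear brackets of subspaces *)

Section Bracket.
Variables (F : fieldType) (L : vectType F) (br : L -> L -> L).
Hypothesis bil : bilinear_br br.

Lemma brDl x y z : br (x + y) z = br x z + br y z.
Proof. by have [] := bil 1 x y z; rewrite !scale1r. Qed.

Lemma brDr z x y : br z (x + y) = br z x + br z y.
Proof. by have [] := bil 1 x y z; rewrite !scale1r. Qed.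

Lemma br0l z : br 0 z = 0.
Proof. by apply: (addrI (br 0 z)); rewrite -brDl !addr0. Qed.

Lemma br0r z : br z 0 = 0.
Proof. by apply: (addrI (br z 0)); rewrite -brDr !addr0. Qed.

Lemma brZl a x z : br (a *: x) z = a *: br x z.
Proof. by have [] := bil a x 0 z; rewrite br0l !addr0. Qed.

Lemma brZr a z x : br z (a *: x) = a *: br z x.
Proof. by have [_] := bil a x 0 z; rewrite br0r !addr0. Qed.

Lemma br_suml I (r : seq I) (Q : pred I) f z :
  br (\sum_(i <- r | Q i) f i) z = \sum_(i <- r | Q i) br (f i) z.
Proof. by apply: (big_morph (br^~ z)) => [x y|]; rewrite ?brDl ?br0l. Qed.

Lemma br_sumr I (r : seq I) (Q : pred I) f z :
  br z (\sum_(i <- r | Q i) f i) = \sum_(i <- r | Q i) br z (f i).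
Proof. by apply: (big_morph (br z)) => [x y|]; rewrite ?brDr ?br0r. Qed.

Lemma mem_brsp (U W : {vspace L}) u w :
  u \in U -> w \in W -> br u w \in brsp br U W.
Proof.
move=> /coord_vbasis -> /coord_vbasis ->.
rewrite br_suml memv_suml // => i _; rewrite br_sumr memv_suml // => j _.
rewrite brZl brZr !memvZ //; apply/memv_span/allpairsP.
by exists ((vbasis U)`_i, (vbasis W)`_j); rewrite !mem_nth ?size_tuple.
Qed.

Lemma brsp_sub (U W X : {vspace L}) :
  sub_br br U W X -> (brsp br U W <= X)%VS.
Proof.
move=> sUW; apply/span_subvP => _ /allpairsP[[u w] /= [Uu Ww ->]].
by apply: sUW; apply: vbasis_mem.
Qed.

Lemma sub_brS (U U' W W' X X' : {vspace L}) :
  (U' <= U)%VS -> (W' <= W)%VS -> (X <= X')%VS ->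
  sub_br br U W X -> sub_br br U' W' X'.
Proof.
by move=> /subvP sU /subvP sW /subvP sX H u w /sU Uu /sW Ww; apply/sX/H.
Qed.

Lemma sub_br_capl (U U' W X X' : {vspace L}) :
  sub_br br U W X -> sub_br br U' W X' -> sub_br br (U :&: U') W (X :&: X').
Proof.
move=> H H' u w; rewrite !memv_cap => /andP[Uu U'u] Ww.
by apply/andP; split; [apply: H | apply: H'].
Qed.

Lemma sub_br_addl (U U' W X : {vspace L}) :
  sub_br br U W X -> sub_br br U' W X -> sub_br br (U + U') W X.
Proof.
move=> H H' _ w /memv_addP[u Uu [u' Uu' ->]] Ww.
by rewrite brDl memvD //; [apply: H | apply: H'].
Qed.

Lemma sub_br_addr (U W W' X : {vspace L}) :
  sub_br br U W X -> sub_br br U W' X -> sub_br br U (W + W') X.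
Proof.
move=> H H' u _ Uu /memv_addP[w Ww [w' Ww' ->]].
by rewrite brDr memvD //; [apply: H | apply: H'].
Qed.

Lemma sub_br_suml (I : finType) (Q : pred I) (U : I -> {vspace L})
    (W X : {vspace L}) :
  (forall i, Q i -> sub_br br (U i) W X) ->
  sub_br br (\sum_(i | Q i) U i)%VS W X.
Proof.
move=> H _ w /memv_sumP[u Uu ->] Ww.
by rewrite br_suml memv_suml // => i Qi; exact: (H i Qi) (Uu i Qi) Ww.
Qed.

Lemma sub_br_sumr (I : finType) (Q : pred I) (W : I -> {vspace L})
    (U X : {vspace L}) :
  (forall i, Q i -> sub_br br U (W i) X) ->
  sub_br br U (\sum_(i | Q i) W i)%VS X.
Proof.
move=> H u _ Uu /memv_sumP[w Ww ->].
by rewrite br_sumr memv_suml // => i Qi; exact: (H i Qi) Uu (Ww i Qi).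
Qed.

End Bracket.

(** * Partial sums of a direct family of subspaces *)

Section DirectFamily.
Variables (F : fieldType) (L : vectType F) (P : finType) (B : P -> {vspace L}).
Hypothesis dirB : directv (\sum_p B p)%VS.
Hypothesis sumB : (\sum_p B p = fullv)%VS.
Hypothesis nzB : forall p, B p != 0%VS.

Definition block_sum (Q : pred P) : {vspace L} := (\sum_(p | Q p) B p)%VS.

Lemma block_sum_cap (Q Q' : pred P) :
  (forall p, Q p -> ~~ Q' p) -> (block_sum Q :&: block_sum Q' = 0)%VS.
Proof.
move=> dQ; apply/eqP; rewrite -subv0; apply/subvP => x.
rewrite memv_cap => /andP[/memv_sumP[u Bu xu] /memv_sumP[v Bv xv]].
(* The two expansions of [x] are merged into one family with sum 0, to which independence
   applies. *)
pose t p := (if Q p then u p else 0) - (if Q' p then v p else 0).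
have t0 p : t p = 0.
  apply: (elimT directv_sum_independent dirB) => // [q _|].
    rewrite /t memvB //; case: ifP => // Qq; rewrite ?mem0v //.
      exact: Bu.
    exact: Bv.
  by rewrite sumrB -!big_mkcond /= -xu -xv subrr.
rewrite xu memv0 big1 // => p Qp.
by have := t0 p; rewrite /t Qp (negPf (dQ p Qp)) subr0.
Qed.

Lemma block_sub_sum (Q : pred P) p : Q p -> (B p <= block_sum Q)%VS.
Proof. by move=> Qp; apply: (sumv_sup p). Qed.

Lemma block_subP (Q : pred P) p : (B p <= block_sum Q)%VS -> Q p.
Proof.
move=> sBQ; apply: contraT => nQp; case/eqP: (nzB p).
apply/eqP; rewrite -subv0 -(@block_sum_cap (pred1 p) Q) => [|q /eqP ->] //.
by rewrite subv_cap sBQ block_sub_sum /=.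
Qed.

Lemma block_sum_compl (Q : pred P) :
  (block_sum Q + block_sum (predC Q) = fullv)%VS.
Proof. by rewrite -sumB (bigID Q). Qed.

Lemma block_sumS (Q : pred P) X :
  (forall p, Q p -> (B p <= X)%VS) -> (block_sum Q <= X)%VS.
Proof. by move=> H; apply/subv_sumP. Qed.

Lemma block_sum_fullP (Q : pred P) : block_sum Q = fullv -> forall p, Q p.
Proof. by move=> fQ p; apply: block_subP; rewrite fQ subvf. Qed.

Lemma block_inj p q : (B p <= B q)%VS -> p = q.
Proof.
move=> sB; apply/eqP; apply: (@block_subP (pred1 q)).
by apply: subv_trans sB _; apply: block_sub_sum => /=.
Qed.

Lemma directv_reindex (I : finType) (h : I -> P) :
  injective h -> directv (\sum_i B (h i))%VS.
Proof.
move=> injh; apply/directv_sum_independent => u Bu u0 i _.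
(* The family [u] is transported along [h] and extended by 0; by injectivity the picked index is the
   only one. *)
pose t p := if [pick j | h j == p] is Some j then u j else 0.
have th j : t (h j) = u j.
  by rewrite /t; case: pickP => [k /eqP/injh ->|/(_ j)/eqP].
rewrite -th; apply: (elimT directv_sum_independent dirB) => // [p _|].
  rewrite /t; case: pickP => [j /eqP <-|_]; last exact: mem0v.
  exact: Bu.
rewrite (bigID [in h @: setT]) /= [X in _ + X]big1 ?addr0; last first.
  move=> p /negP nhp; rewrite /t; case: pickP => // j /eqP hj.
  by case: nhp; rewrite -hj imset_f.
rewrite -[RHS]u0 big_imset /= => [|j k _ _ /injh //].
by apply: eq_big => [j|j _]; rewrite ?inE ?th.
Qed.

End DirectFamily.

(** * Algebras with blocks *)

Section BlockAlgebra.
Variables (F : fieldType) (L : vectType F) (br : L -> L -> L).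
Variables (Vb Wb : finType) (E : Vb -> Wb -> bool).
Variable B : (Vb + Wb)%type -> {vspace L}.

(** Besides acting along the edges, [w] acts on its own block by the adjoint action. *)
Definition act_edge (p : (Vb + Wb)%type) (w : Wb) : bool :=
  match p with inl v => E v w | inr w' => w' == w end.

Hypothesis bil : bilinear_br br.
Hypothesis dirB : directv (\sum_p B p)%VS.
Hypothesis sumB : (\sum_p B p = fullv)%VS.
Hypothesis nzB : forall p, B p != 0%VS.
Hypothesis brM : forall v x y, y \in B (inl v) -> br x y = 0.
Hypothesis edgeB : forall p w, act_edge p w -> brsp br (B p) (B (inr w)) = B p.
Hypothesis nedgeB :
  forall p w, ~~ act_edge p w -> sub_br br (B p) (B (inr w)) 0%VS.
Hypothesis altB : forall w x, x \in B (inr w) -> br x x = 0.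
Hypothesis right_ideal_block :
  forall X, X != 0%VS -> sub_br br X fullv X -> exists p, (B p <= X)%VS.
Hypothesis nisoE : forall v, exists w, E v w.

Let isl (p : (Vb + Wb)%type) : bool := if p is inl _ then true else false.
(** [block_Ispace] identifies this with the span of the squares. *)
Let I : {vspace L} := block_sum B isl.
Let S0 : {vspace L} := block_sum B (predC isl).

Lemma block_right p : sub_br br (B p) fullv (B p).
Proof.
rewrite -sumB; apply: sub_br_sumr => // -[v|w] _.
  by move=> x y _ /brM ->; rewrite mem0v.
have [/edgeB pw|/nedgeB pw] := boolP (act_edge p w).
  by move=> x y Bx By; rewrite -{1}pw mem_brsp.
move=> x y Bx By; have := pw x y Bx By.
by rewrite memv0 => /eqP ->; rewrite mem0v.
Qed.

Lemma block_sum_right Q : sub_br br (block_sum B Q) fullv (block_sum B Q).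
Proof.
apply: sub_br_suml => // p Qp; apply: sub_brS (@block_right p) => //.
exact: block_sub_sum.
Qed.

Lemma brI x y : y \in I -> br x y = 0.
Proof.
move=> /memv_sumP[u Bu ->]; rewrite br_sumr // big1 // => -[v|//] vI.
exact/brM/(Bu _ vI).
Qed.

(** Since [L, I] = 0, stability need only be tested on [S]. This turns submodules for any complement
    of [I] into right ideals. *)
Lemma right_ideal_of_compl (S X : {vspace L}) :
  (S + I = fullv)%VS -> sub_br br X S X -> sub_br br X fullv X.
Proof.
move=> <- XS; apply: sub_br_addr => // x y _ /brI ->; exact: mem0v.
Qed.

(** The part of [X] in the sum of the blocks not contained in [X] is a right ideal; a block inside
    it would be both contained and not contained in [X], so it is 0. The modular law concludes. *)
Lemma right_ideal_blocks (X : {vspace L}) :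
  sub_br br X fullv X -> X = block_sum B [pred p | (B p <= X)%VS].
Proof.
move=> rX; set Q := [pred p | _].
have sQX : (block_sum B Q <= X)%VS by apply: block_sumS.
suff cap0 : (X :&: block_sum B (predC Q) = 0)%VS.
  rewrite -{1}[X]capfv -(block_sum_compl sumB Q) -vspace_modl //.
  by rewrite capvC cap0 addv0.
apply/eqP; apply/negPn/negP => /right_ideal_block[].
  by apply: sub_br_capl => //; apply: block_sum_right.
move=> p; rewrite subv_cap => /andP[pX /(block_subP dirB nzB)].
by rewrite /= pX.
Qed.

Lemma right_ideal_sub (X : {vspace L}) (Q : pred (Vb + Wb)%type) :
  sub_br br X fullv X -> (forall p, (B p <= X)%VS -> Q p) ->
  (X <= block_sum B Q)%VS.
Proof.
move=> /right_ideal_blocks XQ H; rewrite XQ; apply: block_sumS => p pX.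
exact/block_sub_sum/H.
Qed.

Lemma brSS x : x \in S0 -> br x x = 0.
Proof.
move=> /memv_sumP[u Bu ->]; rewrite br_suml // big1 // => p Sp.
rewrite br_sumr // big1 // => q Sq.
case: p q Sp Sq => [//|w] [//|w'] Sp Sq.
have [->|ne] := eqVneq w w'; first exact/altB/(Bu _ Sq).
have := @nedgeB (inr w) w' ne _ _ (Bu _ Sp) (Bu _ Sq).
by rewrite memv0 => /eqP.
Qed.

(** As [L, I] = 0 and [S0] is alternating, the square of i + s is [i, s], which lies in [I].
    Conversely, for a neighbour [w] of [v] these brackets span [B (inl v)]. *)
Lemma block_Ispace : is_Ispace br I.
Proof.
split=> [x|U sqU].
  have: x \in (I + S0)%VS by rewrite (block_sum_compl sumB) memvf.
  move=> /memv_addP[i Ii [s Ss ->]].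
  rewrite brDl // [br s _]brDr // (brI s Ii) (brSS Ss) !addr0.
  by apply: block_sum_right => //; rewrite memvf.
apply: block_sumS => // -[v|//] _; have [w vw] := nisoE v.
rewrite -(edgeB (p := inl v) vw); apply: brsp_sub => i s Bi Bs.
have := sqU (i + s); rewrite (brDl bil) (brDr bil i) (brDr bil s).
by rewrite (brM i Bi) (brM s Bi) (altB Bs) add0r !addr0.
Qed.

Lemma Ispace_block I' : is_Ispace br I' -> I' = I.
Proof.
have [sqI minI] := block_Ispace; move=> [sqI' minI'].
by apply/eqP; rewrite eqEsubv minI ?minI'.
Qed.

(** An ideal not inside [I] contains some [B (inr w)], which is perfect and therefore survives in
    every term of the derived series. *)
Lemma block_semisimple : semisimple_leibniz br.
Proof.
move=> _ /Ispace_block -> J [sIJ rJ] [k solJ].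
have [sJI|nJI] := boolP (J <= I)%VS.
  by apply/eqP; rewrite eqEsubv sIJ sJI.
have [w wJ] : exists w, (B (inr w) <= J)%VS.
  have [p /andP[/= pJ npI]|none] := pickP [pred p | (B p <= J)%VS && ~~ isl p].
    by move: p pJ npI => [//|w] wJ _; exists w.
  case/negP: nJI; apply: right_ideal_sub => // p pJ.
  by have := none p; rewrite /= pJ => /negbFE.
suff: (B (inr w) <= derived_mod br I J k)%VS.
  by move=> /subv_trans/(_ solJ)/(block_subP dirB nzB).
elim: k {solJ} => //= k IHk.
apply: subv_trans (addvSl _ _).
have := edgeB (p := inr w) (eqxx w) => {1}<-; apply: brsp_sub => x y Bx By.
by apply: mem_brsp => //; apply: (subvP IHk).
Qed.

(** * Indecomposability *)

Lemma ideal_blocks_dichotomy (X Y : {vspace L}) p :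
  ideal br X -> ideal br Y -> (X + Y)%VS = fullv ->
  (B p <= X)%VS || (B p <= Y)%VS.
Proof.
move=> [rX _] [rY _] XY.
(* [X] and [Y] are the sums of the blocks they contain, so these blocks together already span the
   algebra. *)
have: block_sum B [pred p | (B p <= X)%VS || (B p <= Y)%VS] = fullv.
  apply/eqP; rewrite eqEsubv subvf -XY subv_add.
  by rewrite !right_ideal_sub //= => q ->; rewrite ?orbT.
by move=> /(block_sum_fullP dirB nzB)/(_ p).
Qed.

(** The block of [v] equals [B_v, B_w], which lies in the right ideal [X] and in the left ideal [Y],
    hence in 0. *)
Lemma ideal_edge (X Y : {vspace L}) v w :
  ideal br X -> ideal br Y -> (X :&: Y)%VS = 0%VS -> E v w ->
  (B (inl v) <= X)%VS -> (B (inr w) <= Y)%VS -> False.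
Proof.
move=> [rX _] [_ lY] XY vw vX wY; case/eqP: (nzB (inl v)); apply/eqP.
rewrite -subv0 -XY -(edgeB (p := inl v) vw); apply: brsp_sub => x y Bx By.
rewrite memv_cap rX ?memvf ?lY ?memvf //; first exact: (subvP wY).
exact: (subvP vX).
Qed.

(** A neighbour of a block in [X] cannot lie in [Y] by [ideal_edge], so it lies in [X];
    connectedness spreads this to all blocks. *)
Lemma ideal_full (X Y : {vspace L}) :
  bip_connected E -> ideal br X -> ideal br Y ->
  (X + Y)%VS = fullv -> (X :&: Y)%VS = 0%VS -> X != 0%VS -> X = fullv.
Proof.
move=> [_ conE] iX iY XY capXY nzX.
have dich p := ideal_blocks_dichotomy p iX iY XY.
have [p pX] := right_ideal_block nzX (proj1 iX).
suff sX q : (B q <= X)%VS.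
  by apply/eqP; rewrite eqEsubv subvf -sumB; apply/subv_sumP.
have [s + ->] := connectP (conE p q).
elim: s p pX => //= r s IHs p pX /andP[pr]; apply: IHs.
have := dich r; case/orP=> // rY.
move: p r pX rY pr => [v|w] [v'|w'] //= pX rY vw.
  by case: (ideal_edge iX iY capXY vw pX rY).
by rewrite capvC in capXY; case: (ideal_edge iY iX capXY vw rY pX).
Qed.

Lemma block_indecomposable : bip_connected E -> indecomposable br.
Proof.
move=> conE [X [Y [iX [iY [nX [_ [fX [_ [XY capXY]]]]]]]]].
by case/eqP: fX; apply: (ideal_full conE iX iY).
Qed.

(** * Existence of the decomposition *)

Lemma block_simple p (X : {vspace L}) :
  (X <= B p)%VS -> sub_br br X fullv X -> X = 0%VS \/ X = B p.
Proof.
move=> sXB rX; have [|nzX] := eqVneq X 0%VS; [by left | right].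
have [q qX] := right_ideal_block nzX rX.
have qp : q = p by apply: (block_inj dirB nzB); apply: subv_trans sXB.
by apply/eqP; rewrite eqEsubv sXB -{1}qp.
Qed.

Lemma S0I : (S0 + I)%VS = fullv.
Proof. by rewrite addvC; apply: block_sum_compl. Qed.

Lemma capS0I : (S0 :&: I)%VS = 0%VS.
Proof. by apply: block_sum_cap => // p /=. Qed.

Lemma sum_inr : (\sum_(i < #|Wb|) B (inr (enum_val i)))%VS = S0.
Proof.
apply/eqP; rewrite eqEsubv; apply/andP; split.
  by apply/subv_sumP => i _; apply: block_sub_sum.
apply: block_sumS => -[//|w] _.
by apply: (sumv_sup (enum_rank w)) => //; rewrite enum_rankK.
Qed.

Lemma sum_inl : (\sum_(i < #|Vb|) B (inl (enum_val i)))%VS = I.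
Proof.
apply/eqP; rewrite eqEsubv; apply/andP; split.
  by apply/subv_sumP => i _; apply: block_sub_sum.
apply: block_sumS => -[v|//] _.
by apply: (sumv_sup (enum_rank v)) => //; rewrite enum_rankK.
Qed.

Lemma block_simple_lie w : simple_lie_subalg br (B (inr w)).
Proof.
split; first exact: sub_brS (subvv _) (subvf _) (subvv _) (@block_right _).
- exact: altB.
- pose e := vbasis (B (inr w)).
  have Be i : e`_i \in B (inr w).
    have [ie|/(nth_default 0) ->] := ltnP i (size e); last exact: mem0v.
    exact/vbasis_mem/mem_nth.
  (* Restricting to basis vectors makes the search for a nonzero bracket finite. If all of them
     vanish, then B_w = [B_w, B_w] = 0. *)
  have [/existsP[i /existsP[j nz]]|none] := boolP
      [exists i : 'I_(\dim (B (inr w))), exists j : 'I_(\dim (B (inr w))), br e`_i e`_j != 0].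
    by exists e`_i, e`_j; split.
  case/eqP: (nzB (inr w)); apply/eqP; rewrite -subv0.
  rewrite -(edgeB (p := inr w) (eqxx w)); apply: brsp_sub.
  move=> x y /coord_vbasis -> /coord_vbasis ->.
  rewrite br_suml // memv_suml // => i _; rewrite br_sumr // memv_suml // => j _.
  rewrite (brZl bil) (brZr bil) !memvZ // memv0.
  move: none; rewrite negb_exists => /forallP/(_ i).
  by rewrite negb_exists => /forallP/(_ j); rewrite negbK.
(* All blocks other than that of [w] act on it by 0, so an ideal of the copy at [w] is a right ideal
   of the whole algebra. *)
move=> J sJ rJ; apply: block_simple => //; rewrite -sumB.
apply: sub_br_sumr => // -[v|w'] _ x y Jx By; first by rewrite (brM x By) mem0v.
have [ww|ne] := eqVneq w w'; first by subst w'; apply: rJ.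
have := @nedgeB (inr w) w' ne _ _ (subvP sJ _ Jx) By.
by rewrite memv0 => /eqP ->; rewrite mem0v.
Qed.

Lemma block_decomposition :
  is_decomposition br I (fun i : 'I_#|Wb| => B (inr (enum_val i)))
    (fun k : 'I_#|Vb| => B (inl (enum_val k))).
Proof.
split; first by move=> i; apply: block_simple_lie.
split; first by apply: (directv_reindex dirB) => i j [] /enum_val_inj.
split.
  by move=> i j ij; apply: nedgeB; rewrite /= (inj_eq enum_val_inj).
rewrite sum_inr; split.
  exact: sub_brS (subvv _) (subvf _) (subvv _) (@block_sum_right _).
split; first exact: S0I.
split; first exact: capS0I.
split; first by apply: (directv_reindex dirB) => i j [] /enum_val_inj.
split; first exact: sum_inl.
move=> k; split=> //.
  exact: sub_brS (subvv _) (subvf _) (subvv _) (@block_right _).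
by move=> X sX rX; apply: block_simple => //; apply: right_ideal_of_compl S0I rX.
Qed.

(** * Uniqueness of the decomposition *)

Section Unique.
Variables (m n : nat) (g : 'I_m -> {vspace L}) (Ik : 'I_n -> {vspace L}).
Hypothesis dec : is_decomposition br I g Ik.
Let S : {vspace L} := (\sum_(i < m) g i)%VS.

(** A summand of [I] is a nonzero right ideal, so it contains a block, necessarily one of [I]; that
    block is a submodule, and simplicity gives equality. *)
Lemma decomp_module k : exists v, Ik k = B (inl v).
Proof.
case: dec => _ [_ [_ [_ [SI [_ [_ [sumI simI]]]]]]].
have [nzI rI minI] := simI k.
have [p pI] := right_ideal_block nzI (right_ideal_of_compl SI rI).
have: (B p <= I)%VS by apply: subv_trans pI _; rewrite -sumI; apply: (sumv_sup k).
move=> /(block_subP dirB nzB); case: p pI => // v vI _; exists v.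
have [|z|->] // := minI _ vI.
  by apply: sub_brS (@block_right _) => //; apply: subvf.
by have := nzB (inl v); rewrite z eqxx.
Qed.

Lemma decomp_gS i : (g i <= S)%VS.
Proof. exact: (sumv_sup i). Qed.

Lemma decomp_g_nz i : g i != 0%VS.
Proof.
case: dec => /(_ i)[_ _ [x [y [gx _ nz]]] _] _.
apply/eqP => g0; move: gx nz; rewrite g0 memv0 => /eqP ->.
by rewrite br0l ?eqxx.
Qed.

Lemma decomp_g_right i : sub_br br (g i) S (g i).
Proof.
case: dec => lie [_ [com _]]; apply: sub_br_sumr => // j _.
have [<-|ij] := eqVneq i j; first by have [] := lie i.
by apply: sub_brS (com i j ij) => //; apply: sub0v.
Qed.

(* Among the blocks making up g_i + I is some B_w outside I, and by simplicity
   the nonzero ideal of g_i that lies over B_w is all of g_i. *)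
Lemma decomp_g i : exists w, (g i + I)%VS = (B (inr w) + I)%VS.
Proof.
have [lie [_ [_ [_ [SI [capSI _]]]]]] := dec.
have [_ _ _ ming] := lie i.
have capg : (g i :&: I)%VS = 0%VS.
  by apply/eqP; rewrite -subv0 -capSI capvS ?decomp_gS.
have rI : sub_br br I fullv I by apply: block_sum_right.
have rgI : sub_br br (g i + I) fullv (g i + I).
  apply: sub_br_addl => //; last by apply: sub_brS rI => //; apply: addvSr.
  apply: sub_brS (right_ideal_of_compl SI (@decomp_g_right i)) => //.
  exact: addvSl.
have [w wg] : exists w, (B (inr w) <= g i + I)%VS.
  have [p /andP[/= pJ npI]|none] :=
      pickP [pred p | (B p <= g i + I)%VS && ~~ isl p].
    by move: p pJ npI => [//|w] wJ _; exists w.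
  case/eqP: (decomp_g_nz i); apply/eqP; rewrite -subv0 -capg subv_cap subvv.
  apply: (subv_trans (addvSl _ I)).
  apply: right_ideal_sub => // p pJ.
  by have := none p; rewrite /= pJ => /negbFE.
exists w; apply/eqP; rewrite eqEsubv !subv_add !addvSr !andbT wg andbT.
have wr : sub_br br (B (inr w) + I) fullv (B (inr w) + I).
  apply: sub_br_addl => //; last by apply: sub_brS rI => //; apply: addvSr.
  by apply: sub_brS (@block_right _) => //; apply: addvSl.
have [||z|<-] := ming (g i :&: (B (inr w) + I))%VS; first exact: capvSl.
- apply: sub_br_capl => //; first by have [] := lie i.
  by apply: sub_brS wr => //; apply: subvf.
(* If the intersection is 0, write x in B_w as s + t with s in [g i] and t in [I]: then s = x - t
   lies in the intersection, so x = t. *)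
- suff: (B (inr w) <= I)%VS by move=> /(block_subP dirB nzB).
  apply/subvP => x Bx; have /memv_addP[s gs [t It xst]] := subvP wg x Bx.
  suff: s \in (g i :&: (B (inr w) + I))%VS.
    by rewrite z memv0 => /eqP s0; rewrite xst s0 add0r.
  rewrite memv_cap gs /=; have -> : s = x + - t by rewrite xst addrK.
  by apply: memv_add; rewrite ?memvN.
exact: capvSr.
Qed.

(** Directness makes both vertex maps injective, and the spanning conditions make them surjective.
    Edges correspond because [g i] and its block agree modulo [I], so they have the same brackets
    with every module. *)
Lemma decomp_bip_iso : bip_iso E (decomp_edge br g Ik).
Proof.
have [_ [dirg [_ [_ [SI [capSI [dirI [sumI _]]]]]]]] := dec.
have [f If] : exists f : 'I_n -> Vb, forall k, Ik k = B (inl (f k)).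
  have ex k : exists v, Ik k == B (inl v)
    by have [v ->] := decomp_module k; exists v.
  by exists (fun k => xchoose (ex k)) => k; apply/eqP/(xchooseP (ex k)).
have [h gh] : exists h : 'I_m -> Wb,
    forall i, (g i + I)%VS = (B (inr (h i)) + I)%VS.
  have ex i : exists w, (g i + I)%VS == (B (inr w) + I)%VS.
    by have [w ->] := decomp_g i; exists w.
  by exists (fun i => xchoose (ex i)) => i; apply/eqP/(xchooseP (ex i)).
exists f, h; split.
- have injf : injective f.
    move=> k l kl; apply: contraTeq (nzB (inl (f k))) => nkl; rewrite negbK.
    rewrite -subv0 -(directv_sumP dirI k) // subv_cap -If subvv /=.
    by apply: (sumv_sup l); rewrite 1?eq_sym // !If kl.
  apply: inj_card_bij => //; rewrite -(card_codom injf).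
  apply/subset_leq_card/subsetP => v _.
  suff: (B (inl v) <=
      block_sum B [pred p | if p is inl u then u \in codom f else false])%VS.
    by move=> /(block_subP dirB nzB).
  apply: (@subv_trans _ _ I); first exact: block_sub_sum.
  rewrite -sumI; apply/subv_sumP => k _; rewrite If; apply: block_sub_sum.
  exact: codom_f.
- have injh : injective h.
    (* If [h i = h j] then [g i] lies in g_j + I; the component in [I] also lies in [S], so it is 0,
       and [g i] would lie in [g j]. *)
    move=> i j ij; apply: contraTeq (decomp_g_nz i) => nij; rewrite negbK.
    rewrite -subv0 -(directv_sumP dirg i) // subv_cap subvv /=.
    apply: (sumv_sup j); first by rewrite eq_sym.
    apply/subvP => x gx.
    have: x \in (g j + I)%VS by rewrite gh -ij -gh (subvP (addvSl _ _)).
    move=> /memv_addP[y gy [t It xyt]].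
    have: t \in (0%VS : {vspace L}).
      rewrite -capSI memv_cap It andbT.
      have -> : t = x - y by rewrite xyt addrC addKr.
      by apply: memvB; [apply: (subvP (decomp_gS i))|apply: (subvP (decomp_gS j))].
    by rewrite memv0 => /eqP t0; rewrite xyt t0 addr0.
  apply: inj_card_bij => //; rewrite -(card_codom injh).
  apply/subset_leq_card/subsetP => w _.
  suff: (B (inr w) <=
      block_sum B [pred p | if p is inr u then u \in codom h else true])%VS.
    by move=> /(block_subP dirB nzB).
  apply: (@subv_trans _ _ fullv); first exact: subvf.
  rewrite -SI subv_add; apply/andP; split; last first.
    by apply: block_sumS => -[v|//] _; apply: block_sub_sum.
  apply/subv_sumP => i _; apply: (subv_trans (addvSl _ I)); rewrite gh subv_add.
  apply/andP; split; first by apply: block_sub_sum; apply: codom_f.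
  by apply: block_sumS => -[v|//] _; apply: block_sub_sum.
move=> k i; rewrite /decomp_edge If.
have swap (U W : {vspace L}) : (U <= W + I)%VS ->
    (brsp br (B (inl (f k))) U <= brsp br (B (inl (f k))) W)%VS.
  move=> /subvP sU; apply: brsp_sub => x y Bx /sU/memv_addP[s Ws [t It ->]].
  by rewrite brDr // (brI x It) addr0 mem_brsp.
have -> : brsp br (B (inl (f k))) (g i) = brsp br (B (inl (f k))) (B (inr (h i))).
  by apply/eqP; rewrite eqEsubv !swap // -?gh ?addvSl // gh addvSl.
have [/(edgeB (p := inl _))->|ne] := boolP (E (f k) (h i)); first by rewrite eqxx.
apply/esym/eqP => eqB; case/eqP: (nzB (inl (f k))); apply/eqP.
by rewrite -eqB -subv0; apply: brsp_sub; apply: (@nedgeB (inl (f k))).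
Qed.

End Unique.

End BlockAlgebra.

(** * The algebra of a bipartite graph *)

Section TensorModule.
Variables (F : fieldType) (Vb Wb : finType) (E : Vb -> Wb -> bool).
Hypothesis charF0 : forall n, (n%:R == 0 :> F) = (n == 0)%N.
Hypothesis nisoE : forall v, exists w, E v w.

Local Notation vertex := (Vb + Wb)%type.
Local Notation weight := {ffun Wb -> nat}.
Implicit Types (p q : vertex) (w : Wb) (a : weight) (t : (vertex * weight)%type).

(* The block of p is the tensor product over w of the modules V(hw p w). *)
Definition hw p w : nat :=
  match p with
  | inl v => if E v w then (enum_rank v).+3 else 0%N
  | inr w' => if w' == w then 2%N else 0%N
  end.

Definition upd a w j : weight := [ffun w' => if w' == w then j else a w'].

Definition pt w j : weight := upd [ffun=> 0%N] w j.

Lemma updE a w j : upd a w j w = j.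
Proof. by rewrite ffunE eqxx. Qed.

Lemma upd_neq a w j w' : w' != w -> upd a w j w' = a w'.
Proof. by rewrite ffunE => /negPf ->. Qed.

Lemma upd_upd a w i j : upd (upd a w i) w j = upd a w j.
Proof. by apply/ffunP => w'; rewrite !ffunE; case: eqP. Qed.

Lemma upd_id a w : upd a w (a w) = a.
Proof. by apply/ffunP => w'; rewrite !ffunE; case: eqP => // ->. Qed.

Lemma upd_comm a w w' i j : w != w' ->
  upd (upd a w i) w' j = upd (upd a w' j) w i.
Proof.
move=> /negPf ne; apply/ffunP => u; rewrite !ffunE.
by case: (eqVneq u w) => [->|//]; rewrite ne.
Qed.

Definition adm t : bool := [forall w, t.2 w <= hw t.1 w]%N.

Lemma adm_upd p a w j : adm (p, a) -> (j <= hw p w)%N -> adm (p, upd a w j).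
Proof.
move=> /forallP /= A jw; apply/forallP => w' /=; rewrite ffunE.
by case: eqP => // ->.
Qed.

Lemma nadm_large p a w : (hw p w < a w)%N -> ~~ adm (p, a).
Proof. by move=> lt; rewrite negb_forall; apply/existsP; exists w; rewrite -ltnNge. Qed.

Lemma adm0 p : adm (p, [ffun=> 0%N]).
Proof. by apply/forallP => w; rewrite ffunE. Qed.

Lemma adm_pt w j : (j <= 2)%N -> adm (inr w, pt w j).
Proof. by move=> j2; apply: adm_upd; rewrite ?adm0 //= eqxx. Qed.

(** A uniform bound, so that the admissible labels can be listed through finite functions into an
    ordinal. *)
Definition max_hw : nat := \max_(u : vertex * Wb) hw u.1 u.2.

(* (p, a) stands for the tensor product over w of the vectors u_(a w) in the
   block of p. *)
Definition basis : seq (vertex * weight) :=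
  undup [seq t <- [seq (p, [ffun w => val ((b : {ffun Wb -> 'I_max_hw.+1}) w)]) |
                    p <- enum {: vertex},
                    b <- enum {: {ffun Wb -> 'I_max_hw.+1}}] | adm t].

Lemma mem_basis t : (t \in basis) = adm t.
Proof.
rewrite mem_undup mem_filter andb_idr // => /forallP A.
apply/allpairsP; exists (t.1, [ffun w => inord (t.2 w)]); rewrite !mem_enum; split=> //=.
case: t A => p a /= A; congr pair; apply/ffunP => w; rewrite !ffunE inordK //.
by rewrite ltnS (leq_trans (A w)) // (@leq_bigmax _ (fun u => hw u.1 u.2) (p, w)).
Qed.

Lemma uniq_basis : uniq basis.
Proof. exact: undup_uniq. Qed.

Local Notation cf := (@cf F _ basis).
Local Notation unit_vec := (unit_vec F basis).
Local Notation L := ('rV[F]_(size basis)).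
Implicit Types (x y z : L) (f : (vertex * weight)%type -> F).

(** * The bracket and the Leibniz identity *)

Lemma cf_nadm x t : ~~ adm t -> cf x t = 0.
Proof. by rewrite -mem_basis; apply: cf_out. Qed.

(* The w-component of y in sl_2 = V(2). *)
Definition crd w y (j : nat) : F := cf y (inr w, pt w j).

(** The copy of sl_2 at [w] acts on the [w]-th tensor factor: the values of [f] on the line through
    [t] in direction [w] are read as a vector of V(hw t.1 w). *)
Definition summand w y f t : F :=
  line_op (hw t.1 w) (crd w y) (fun j => f (t.1, upd t.2 w j)) (t.2 w).

Definition act y f t : F := \sum_w summand w y f t.

Definition block_br x y : L := vec_of_fun basis (act y (cf x)).

Lemma summand0 w y f t :
  (forall j, f (t.1, upd t.2 w j) = 0) -> summand w y f t = 0.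
Proof. exact: line_op0r. Qed.

(** Truncation to the basis loses nothing. At a label too large at [w], the summand of [w] vanishes
    by [line_op_supp], and the others only see labels that are still too large at [w]. *)
Lemma cf_block_br x y : cf (block_br x y) = act y (cf x).
Proof.
apply: functional_extensionality => t; rewrite /block_br cf_vec_of_fun; case: ifP => // /negbT.
rewrite mem_basis negb_forall => /existsP[w]; rewrite -ltnNge => tw.
rewrite /act big1 // => w' _; have [->|ne] := eqVneq w' w.
  apply: line_op_supp tw => i iw; apply/cf_nadm/(@nadm_large _ _ w).
  by rewrite updE.
apply: summand0 => j; apply/cf_nadm/(@nadm_large _ _ w).
by rewrite upd_neq // eq_sym.
Qed.

Lemma block_br_bilinear : bilinear_br block_br.
Proof.
move=> a x y z; split; apply: cf_inj; rewrite ?uniq_basis // => t.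
  rewrite cfP !cf_block_br /act mulr_sumr -big_split /=; apply: eq_bigr => w _.
  rewrite -line_opPr /summand; congr line_op.
  by apply: functional_extensionality => i; rewrite cfP.
rewrite cfP !cf_block_br /act mulr_sumr -big_split /=; apply: eq_bigr => w _.
rewrite -line_opPl /summand; congr line_op.
by apply: functional_extensionality => i; rewrite /crd cfP.
Qed.

Lemma crd_large w y i : (2 < i)%N -> crd w y i = 0.
Proof. by move=> i2; apply/cf_nadm/(@nadm_large _ _ w); rewrite /= eqxx updE. Qed.

Lemma summand_hw0 w y x t : hw t.1 w = 0%N -> summand w y (cf x) t = 0.
Proof.
move=> t0; rewrite /summand t0; apply: line_op0 => i i0.
by apply/cf_nadm/(@nadm_large _ _ w); rewrite updE t0.
Qed.

(** On the block of [w] every other copy acts through the trivial module V(0). *)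
Lemma crd_block_br w y z : crd w (block_br y z) = line_op 2 (crd w z) (crd w y).
Proof.
apply: functional_extensionality => j; rewrite {1}/crd cf_block_br /act.
rewrite (bigD1 w) //= [X in _ + X]big1 ?addr0 => [|w' ne]; last first.
  by apply: summand_hw0; rewrite /= eq_sym (negPf ne).
rewrite /summand /= eqxx updE; congr line_op.
by apply: functional_extensionality => i; rewrite /= upd_upd.
Qed.

Lemma summand_summand w y z f t :
  summand w z (summand w y f) t =
  line_op (hw t.1 w) (crd w z)
    (line_op (hw t.1 w) (crd w y) (fun j => f (t.1, upd t.2 w j))) (t.2 w).
Proof.
rewrite /summand; congr line_op; apply: functional_extensionality => j /=.
by rewrite updE; congr line_op; apply: functional_extensionality => i; rewrite upd_upd.
Qed.

Lemma summand_comm w w' y z f t : w != w' ->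
  summand w z (summand w' y f) t = summand w' y (summand w z f) t.
Proof.
move=> ne; rewrite /summand /=.
transitivity (line_op (hw t.1 w) (crd w z) (fun j =>
    line_op (hw t.1 w') (crd w' y)
      (fun i => f (t.1, upd (upd t.2 w j) w' i)) (t.2 w')) (t.2 w)).
  by congr line_op; apply: functional_extensionality => j; rewrite upd_neq // eq_sym.
rewrite line_op_comm; congr line_op; apply: functional_extensionality => i.
rewrite upd_neq //; congr line_op; apply: functional_extensionality => j.
by rewrite upd_comm.
Qed.

Lemma act_act y z f t :
  act z (act y f) t = \sum_w \sum_w' summand w z (summand w' y f) t.
Proof. by apply: eq_bigr => w _; rewrite /summand -line_op_sum. Qed.

(** In the commutator of two actions, terms for different tensor factors cancel in pairs. The
    diagonal terms are sl_2 relations on a single factor, and [crd_block_br] recognises the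
    component of [y, z]. *)
Lemma block_br_leibniz : leibniz_identity block_br.
Proof.
move=> x y z; apply: cf_inj => [|t]; first exact: uniq_basis.
rewrite cfD !cf_block_br; apply/eqP; rewrite addrC -subr_eq; apply/eqP.
rewrite !act_act [X in _ - X]exchange_big -sumrB; apply: eq_bigr => w _.
rewrite -sumrB (bigD1 w) //= [X in _ + X]big1 ?addr0; last first.
  by move=> w' ne; rewrite summand_comm ?subrr // eq_sym.
by rewrite !summand_summand line_op_lie ?crd_large // -crd_block_br.
Qed.

(** * The blocks and their mutual brackets *)

Definition block p : {vspace L} :=
  (<<[seq unit_vec t | t <- basis & t.1 == p]>>)%VS.

Lemma mem_unit_vec t : adm t -> unit_vec t \in block t.1.
Proof.
by move=> A; apply/memv_span/map_f; rewrite mem_filter eqxx mem_basis.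
Qed.

Lemma memv_blockP p x :
  reflect (forall t, t.1 != p -> cf x t = 0) (x \in block p).
Proof.
rewrite /block; set e := map _ _.
apply: (iffP idP) => [Bx t ne|x0].
  rewrite (coord_span (X := in_tuple e) Bx) cf_sum big1 // => i _; rewrite cfZ.
  have /mapP[t'] : e`_i \in e by rewrite mem_nth.
  rewrite mem_filter => /andP[/eqP t'p _] ->; rewrite cf_unit.
  by case: (eqVneq t t') ne => [->|]; rewrite ?t'p ?eqxx // andbF mulr0.
rewrite -/(block p) [x]cf_expand ?uniq_basis // big_seq memv_suml // => t.
rewrite mem_basis => tb; have [<-|/x0 ->] := eqVneq t.1 p.
  by rewrite memvZ ?mem_unit_vec.
by rewrite scale0r mem0v.
Qed.

Lemma block_sub p (X : {vspace L}) :
  (forall a, adm (p, a) -> unit_vec (p, a) \in X) -> (block p <= X)%VS.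
Proof.
move=> H; apply/span_subvP => u /mapP[[q a]]; rewrite mem_filter mem_basis /=.
by move=> /andP[/eqP -> A] ->; apply: H.
Qed.

Lemma unit_vec_neq0 t : adm t -> unit_vec t != 0.
Proof.
move=> A; apply/(cf_eq0P uniq_basis); exists t.
by rewrite cf_unit mem_basis A eqxx oner_neq0.
Qed.

Lemma block_neq0 p : block p != 0%VS.
Proof.
apply/eqP => p0; have := mem_unit_vec (adm0 p).
by rewrite p0 memv0 (negPf (unit_vec_neq0 (adm0 p))).
Qed.

Lemma block_direct : directv (\sum_p block p)%VS.
Proof.
apply/directv_sum_independent => u Bu u0 p _.
apply: cf_inj; rewrite ?uniq_basis // => t.
rewrite cf0; have [tp|] := eqVneq t.1 p; last by move/memv_blockP: (Bu p isT); apply.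
have := congr1 (fun x => cf x t) u0.
rewrite /= cf0 cf_sum (bigD1 p) //= big1 ?addr0 //.
by move=> q qp; move/memv_blockP: (Bu q isT); apply; rewrite tp eq_sym.
Qed.

Lemma block_total : (\sum_p block p = fullv)%VS.
Proof.
apply/eqP; rewrite eqEsubv subvf; apply/subvP => x _.
rewrite [x]cf_expand ?uniq_basis // big_seq memv_suml // => t; rewrite mem_basis => A.
by rewrite memvZ // (subvP (sumv_sup t.1 _ (subvv _))) ?mem_unit_vec.
Qed.

Lemma block_br_block p x y : x \in block p -> block_br x y \in block p.
Proof.
move=> /memv_blockP x0; apply/memv_blockP => t tp; rewrite cf_block_br /act big1 // => w _.
by apply: summand0 => j; apply: x0.
Qed.

Lemma crd_block p w y j : y \in block p -> p != inr w -> crd w y j = 0.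
Proof. by move=> /memv_blockP y0 pw; apply: y0; rewrite eq_sym. Qed.

Lemma block_br_inl v x y : y \in block (inl v) -> block_br x y = 0.
Proof.
move=> By; apply: cf_inj; rewrite ?uniq_basis // => t.
rewrite cf0 cf_block_br /act big1 // => w _.
by apply: line_op0l => i; apply: crd_block By _.
Qed.

Lemma cf_block_br_inr w x y t :
  y \in block (inr w) -> cf (block_br x y) t = summand w y (cf x) t.
Proof.
move=> By; rewrite cf_block_br /act (bigD1 w) //= big1 ?addr0 // => w' ne.
apply: line_op0l => i; apply: crd_block By _.
by apply: contraNneq ne => -[->].
Qed.

Lemma hw_gt0 p w : (0 < hw p w)%N = act_edge E p w.
Proof. by case: p => [v|w'] /=; case: ifP. Qed.

Lemma block_br_nedge p w :
  ~~ act_edge E p w -> sub_br block_br (block p) (block (inr w)) 0%VS.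
Proof.
rewrite -hw_gt0 -eqn0Ngt => /eqP pw x y Bx By; rewrite memv0; apply/eqP.
apply: cf_inj; rewrite ?uniq_basis // => t; rewrite cf0.
have [tp|tp] := eqVneq t.1 p; last by move/memv_blockP: (block_br_block y Bx); apply.
by rewrite (cf_block_br_inr _ _ By) summand_hw0 // tp.
Qed.

Lemma block_br_alt w x : x \in block (inr w) -> block_br x x = 0.
Proof.
move=> Bx; apply: cf_inj; rewrite ?uniq_basis // => t; rewrite cf0.
have [A|] := boolP (adm t); last exact: cf_nadm.
have [tp|tp] := eqVneq t.1 (inr w); last first.
  by move/memv_blockP: (block_br_block x Bx); apply.
rewrite (cf_block_br_inr _ _ Bx) /summand tp /= eqxx
  -[RHS](line_op_alt (t.2 w) (@crd_large w x)).
(* An admissible label of the block of [w] is 0 off [w], so [upd t.2 w j] is [pt w j] and the line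
   through [t] is [crd w x] itself. *)
congr line_op; apply: functional_extensionality => j; congr cf; congr pair.
apply/ffunP => w'; rewrite !ffunE; case: (eqVneq w' w) => // ne.
by have /forallP/(_ w') := A; rewrite tp /= eq_sym (negPf ne) leqn0 => /eqP.
Qed.

(** * The elements acting as -2e, h and 2f at each [w] *)

Definition sl2_vec w k : L := unit_vec (inr w, pt w k).

Lemma sl2_vec_block w k : (k <= 2)%N -> sl2_vec w k \in block (inr w).
Proof. by move=> k2; apply: (mem_unit_vec (adm_pt w k2)). Qed.

Lemma pt_eq w i j : (pt w i == pt w j) = (i == j).
Proof.
apply/eqP/eqP => [|-> //]; move/(congr1 (fun a : weight => a w)).
by rewrite !updE.
Qed.

Lemma crd_sl2_vec w j k : (k <= 2)%N -> crd w (sl2_vec w k) j = (j == k)%:R.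
Proof.
move=> k2; rewrite /crd cf_unit mem_basis xpair_eqE eqxx pt_eq /=.
by case: eqP => [->|]; rewrite ?andbF // adm_pt.
Qed.

Lemma cf_raise w x t :
  cf (block_br x (sl2_vec w 0)) t = - (2 * (t.2 w).+1%:R * cf x (t.1, upd t.2 w (t.2 w).+1)).
Proof.
rewrite (cf_block_br_inr _ _ (sl2_vec_block _ _)) // /summand /line_op !crd_sl2_vec //=.
by ring.
Qed.

Lemma cf_cartan w x t :
  cf (block_br x (sl2_vec w 1)) t = ((hw t.1 w)%:R - 2 * (t.2 w)%:R) * cf x t.
Proof.
rewrite (cf_block_br_inr _ _ (sl2_vec_block _ _)) // /summand /line_op !crd_sl2_vec //=.
by rewrite upd_id -surjective_pairing; ring.
Qed.

Lemma cf_lower w x t :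
  cf (block_br x (sl2_vec w 2)) t =
  2 * (if t.2 w is i.+1 then ((hw t.1 w)%:R - i%:R) * cf x (t.1, upd t.2 w i) else 0).
Proof.
rewrite (cf_block_br_inr _ _ (sl2_vec_block _ _)) // /summand /line_op !crd_sl2_vec //=.
by case: (t.2 w) => [|i]; ring.
Qed.

Lemma raise_unit w p a : adm (p, a) -> a w = 0%N -> (0 < hw p w)%N ->
  block_br (unit_vec (p, upd a w 1)) (sl2_vec w 0) = -2 *: unit_vec (p, a).
Proof.
move=> A aw pw; apply: cf_inj; rewrite ?uniq_basis // => -[q b].
rewrite cf_raise cfZ !cf_unit !mem_basis /=.
have [[-> ->]|ne] := eqVneq (q, b) (p, a).
  by rewrite aw eqxx A adm_upd //=; ring.
rewrite (_ : (_ == _) = false); first by rewrite !andbF !mulr0 oppr0.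
apply: contraNF ne => /eqP[-> /ffunP ab]; apply/eqP; congr pair.
apply/ffunP => w'; have := ab w; rewrite !updE => -[bw].
by have [->|ne] := eqVneq w' w; [rewrite bw aw | have := ab w'; rewrite !upd_neq].
Qed.

Lemma lower_unit w p a j : adm (p, a) -> a w = j.+1 ->
  block_br (unit_vec (p, upd a w j)) (sl2_vec w 2) =
  (2 * (hw p w - j)%:R) *: unit_vec (p, a).
Proof.
move=> A aw; have jp : (j < hw p w)%N by have /forallP/(_ w) := A; rewrite /= aw.
apply: cf_inj; rewrite ?uniq_basis // => -[q b].
rewrite cf_lower cfZ !cf_unit !mem_basis /=.
have [[-> ->]|ne] := eqVneq (q, b) (p, a).
  by rewrite aw /= cf_unit mem_basis eqxx A adm_upd ?(ltnW jp) //= natrB ?(ltnW jp) //; ring.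
rewrite andbF mulr0; case bw: (b w) => [|i]; first by rewrite mulr0.
rewrite cf_unit (_ : (_ == _) = false); first by rewrite !andbF !mulr0.
apply: contraNF ne => /eqP[-> /ffunP ab]; apply/eqP; congr pair.
apply/ffunP => w'; have := ab w; rewrite !updE => ij.
by have [->|ne] := eqVneq w' w; [rewrite bw aw ij | have := ab w'; rewrite !upd_neq].
Qed.

Lemma memvZ_inv (X : {vspace L}) (c : F) x : c != 0 -> c *: x \in X -> x \in X.
Proof. by move=> c0 /(memvZ c^-1); rewrite scalerA mulVf // scale1r. Qed.

Lemma natr_charF0_inj : injective (fun n => n%:R : F).
Proof.
move=> m n; wlog mn : m n / (m <= n)%N => [H|/= /eqP Emn].
  by case/orP: (leq_total m n) => /H // nm /esym/nm.
apply/eqP; rewrite eqn_leq mn -subn_eq0 -charF0 natrB // subr_eq0 eq_sym.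
exact: Emn.
Qed.

Lemma two_neq0 : 2 != 0 :> F.
Proof. by rewrite charF0. Qed.

(** Up to a nonzero scalar, a basis vector with [a w = 0] is obtained by raising at [w] from 1, and
    any other by lowering at [w] from [a w - 1]. *)
Lemma brsp_block p w :
  act_edge E p w -> brsp block_br (block p) (block (inr w)) = block p.
Proof.
rewrite -hw_gt0 => pw; apply/eqP; rewrite eqEsubv; apply/andP; split.
  by apply: brsp_sub => x y Bx _; apply: block_br_block.
apply: block_sub => a A; case aw: (a w) => [|j].
  apply: (@memvZ_inv _ (-2)); rewrite ?oppr_eq0 ?two_neq0 // -(raise_unit A aw pw).
  by apply: (mem_brsp block_br_bilinear); rewrite ?sl2_vec_block // (mem_unit_vec (adm_upd A pw)).
have jp : (j < hw p w)%N by have /forallP/(_ w) := A; rewrite /= aw.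
apply: (@memvZ_inv _ (2 * (hw p w - j)%:R)).
  by rewrite mulf_neq0 ?two_neq0 // charF0 subn_eq0 -ltnNge.
rewrite -(lower_unit A aw); apply: (mem_brsp block_br_bilinear); rewrite ?sl2_vec_block //.
by rewrite (mem_unit_vec (adm_upd A (ltnW jp))).
Qed.

(** The shift by 3 keeps the value of [inl v] at a neighbour away from the values 0 and 2 of
    [inr w], and this value determines the rank of [v]. *)
Lemma hw_inj p q : hw p =1 hw q -> p = q.
Proof.
have odd v w' : hw (inl v) =1 hw (inr w') -> False.
  by have [w vw] := nisoE v; move=> /(_ w) /=; rewrite vw; case: eqP.
case: p q => [v|w] [v'|w'] H.
- have [w vw] := nisoE v; have := H w; rewrite /= vw; case: ifP => // _ [].
  by move=> /ord_inj/enum_rank_inj ->.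
- by case: (odd _ _ H).
- by case: (odd _ _ (fsym H)).
by have := H w'; rewrite /= eqxx; case: eqP => // ->.
Qed.

(** The number of lowering steps from the highest weight vector. *)
Definition height a : nat := \sum_w a w.

Lemma height_upd a w j : (height (upd a w j) + a w = height a + j)%N.
Proof.
rewrite /height (bigD1 w) //= [in RHS](bigD1 w) //= updE.
rewrite (eq_bigr a) => [|w' ne]; last by rewrite upd_neq.
by rewrite addnAC [in RHS]addnAC addnC [RHS]addnC; congr addn; rewrite addnC.
Qed.

Lemma height_lt a w j : (a w < j)%N -> (height a < height (upd a w j))%N.
Proof. by move=> aj; rewrite -(ltn_add2r (a w)) height_upd ltn_add2l. Qed.

Lemma height_gt a w j : (j < a w)%N -> (height (upd a w j) < height a)%N.
Proof. by move=> ja; rewrite -(ltn_add2r (a w)) height_upd ltn_add2l. Qed.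

(** * Every nonzero right ideal contains a block *)

Section RightIdeal.
Variable X : {vspace L}.
Hypothesis rX : sub_br block_br X fullv X.

(** Induction on the largest height in the support: a raising operator that does not kill [x] lowers
    it, and a vector killed by all of them is supported at height 0. *)
Lemma highest_vector x : x \in X -> x != 0 ->
  exists2 y, y \in X /\ y != 0 & forall p a, a != [ffun=> 0%N] -> cf y (p, a) = 0.
Proof.
have [n] := ubnP (\max_(t <- basis | cf x t != 0) height t.2).
elim: n x => // n IHn x; rewrite ltnS => hx Xx nzx.
have supp p a : (n < height a)%N -> cf x (p, a) = 0.
  move=> na; apply/eqP; apply: contraTT na; rewrite -leqNgt => nz.
  apply: leq_trans hx.
  have tb : (p, a) \in basis by apply: contraNT nz => /cf_out ->.
  by rewrite (big_rem _ tb) nz /= leq_maxl.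
have [/existsP[w nzw]|none] := boolP [exists w, block_br x (sl2_vec w 0) != 0].
  apply: (IHn (block_br x (sl2_vec w 0))) => //; last by apply: rX; rewrite ?memvf.
  case/(cf_eq0P uniq_basis): nzw => -[p a]; rewrite cf_raise /= => nz.
  have n0 : (0 < n)%N.
    rewrite lt0n; apply: contraNneq nz => n0; rewrite supp ?mulr0 ?oppr0 // n0.
    exact: leq_ltn_trans (height_lt _).
  rewrite -(prednK n0) ltnS; apply/bigmax_leqP_seq => -[q b] _.
  rewrite cf_raise /= => nzq.
  rewrite leqNgt; apply: contra nzq => hb; rewrite supp ?mulr0 ?oppr0 //.
  by rewrite -(prednK n0) (leq_ltn_trans hb) // height_lt.
exists x => // p a nza.
have [w aw] : exists w, a w != 0%N.
  apply/existsP; apply: contraNT nza; rewrite negb_exists => /forallP a0.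
  by apply/eqP/ffunP => w; rewrite ffunE; apply/eqP; rewrite -[_ == _]negbK.
move: none; rewrite negb_exists => /forallP/(_ w); rewrite negbK => /eqP xw.
(* The coordinate of the raised vector one step above [a] is -2 (a w) times that of [x] at [a], and
   the factor is nonzero. *)
have := cf_raise w x (p, upd a w (a w).-1); rewrite xw cf0 /= upd_upd updE.
rewrite prednK ?lt0n // upd_id => /esym/eqP; rewrite oppr_eq0 !mulf_eq0 !charF0.
by rewrite (negPf aw) /= => /eqP.
Qed.

(** Induction on the number of blocks in the support of [x]. *)
Lemma highest_unit x : x \in X -> x != 0 ->
  (forall p a, a != [ffun=> 0%N] -> cf x (p, a) = 0) ->
  exists p, unit_vec (p, [ffun=> 0%N]) \in X.
Proof.
have [n] := ubnP #|[pred p | cf x (p, [ffun=> 0%N]) != 0]|.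
elim: n x => // n IHn x; rewrite ltnS => hx Xx nzx x0.
have [[p a] nzp] := elimT (cf_eq0P uniq_basis x) nzx.
have a0 : a = [ffun=> 0%N] by apply/eqP; apply: contraNT nzp => /(x0 p) ->.
rewrite {}a0 in nzp.
have [q /andP[qp nzq]|none] :=
  pickP [pred q | (q != p) && (cf x (q, [ffun=> 0%N]) != 0)].
  have [/existsP[w pw]|/existsPn same] :=
    boolP [exists w, hw p w != hw q w]; last first.
    case/eqP: qp; apply/esym/hw_inj => w; apply/eqP.
    by have := same w; rewrite negbK.
  (* Subtracting the eigenvalue of [p] removes [p] from the support, and [q] stays since its
     eigenvalue at [w] differs. *)
  pose y := block_br x (sl2_vec w 1) - (hw p w)%:R *: x.
  have cfy r b : cf y (r, b) = ((hw r w)%:R - (hw p w)%:R) * cf x (r, b).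
    rewrite /y cfD -scaleNr cfZ cf_cartan /=.
    have [->|/(x0 r) ->] := eqVneq b [ffun=> 0%N]; last by ring.
    by rewrite ffunE; ring.
  apply: (IHn y).
  - apply: leq_trans hx; apply/proper_card/properP; split.
      apply/subsetP => r; rewrite !inE cfy; apply: contraNneq => ->.
      by rewrite mulr0.
    by exists p; rewrite !inE ?nzp // cfy subrr mul0r eqxx.
  - by rewrite memvB ?memvZ // rX ?memvf.
  - apply/(cf_eq0P uniq_basis); exists (q, [ffun=> 0%N]); rewrite cfy mulf_neq0 //.
    apply: contraNneq pw => /eqP; rewrite subr_eq0 => /eqP Epq.
    by rewrite eq_sym; apply/eqP; move: Epq; apply: natr_charF0_inj.
  by move=> r b /(x0 r) xb; rewrite cfy xb mulr0.
exists p; apply: (@memvZ_inv _ (cf x (p, [ffun=> 0%N]))) => //.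
suff <- : x = cf x (p, [ffun=> 0%N]) *: unit_vec (p, [ffun=> 0%N]) by [].
apply: cf_inj; rewrite ?uniq_basis // => -[q b]; rewrite cfZ cf_unit mem_basis.
have [[-> ->]|ne] := eqVneq (q, b) (p, [ffun=> 0%N]); first by rewrite adm0 mulr1.
rewrite andbF mulr0; have [b0|/(x0 q) //] := eqVneq b [ffun=> 0%N].
have := none q; rewrite /= b0 xpair_eqE eqxx andbT in ne *.
by rewrite ne /= => /negbFE/eqP.
Qed.

(** Induction on the height: each further basis vector is a nonzero multiple of a lowered one. *)
Lemma highest_block p : unit_vec (p, [ffun=> 0%N]) \in X -> (block p <= X)%VS.
Proof.
move=> Xp; apply: block_sub => a.
have [n] := ubnP (height a); elim: n a => // n IHn a; rewrite ltnS => ha A.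
have [->//|nza] := eqVneq a [ffun=> 0%N].
have [w aw] : exists w, a w != 0%N.
  apply/existsP; apply: contraNT nza; rewrite negb_exists => /forallP a0.
  by apply/eqP/ffunP => w; rewrite ffunE; apply/eqP; rewrite -[_ == _]negbK.
case aj: (a w) aw => [//|j] _.
have jp : (j < hw p w)%N by have /forallP/(_ w) := A; rewrite /= aj.
apply: (@memvZ_inv _ (2 * (hw p w - j)%:R)).
  by rewrite mulf_neq0 ?two_neq0 // charF0 subn_eq0 -ltnNge.
rewrite -(lower_unit A aj); apply: rX; rewrite ?memvf //.
apply: IHn; last exact: adm_upd (ltnW jp).
by rewrite (leq_trans _ ha) // height_gt ?aj.
Qed.

End RightIdeal.

Lemma right_ideal_block (X : {vspace L}) :
  X != 0%VS -> sub_br block_br X fullv X -> exists p, (block p <= X)%VS.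
Proof.
move=> nzX rX; have nz : vpick X != 0 by rewrite vpick0.
have [y [Xy nzy] y0] := highest_vector rX (memv_pick X) nz.
have [p Xp] := highest_unit rX Xy nzy y0.
by exists p; apply: highest_block.
Qed.

End TensorModule.

Theorem theorem3p8 (Vb Wb : finType) (E : Vb -> Wb -> bool) :
  bip_connected E -> (0 < #|Wb|)%nat ->
  exists (d : nat) (br : 'rV[Cfield]_d -> 'rV[Cfield]_d -> 'rV[Cfield]_d)
         (I : {vspace 'rV[Cfield]_d}),
    bilinear_br br /\ leibniz_identity br /\ is_Ispace br I /\
        semisimple_leibniz br /\ indecomposable br /\
        (exists m n (g : 'I_m -> {vspace 'rV[Cfield]_d})
                    (Ik : 'I_n -> {vspace 'rV[Cfield]_d}),
            is_decomposition br I g Ik) /\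
        (forall m n (g : 'I_m -> {vspace 'rV[Cfield]_d})
                    (Ik : 'I_n -> {vspace 'rV[Cfield]_d}),
            is_decomposition br I g Ik ->
            bip_iso E (decomp_edge br g Ik)).
Proof.
move=> conE /card_gt0P[w0 _].
have nisoE v : exists w, E v w.
  (* The first step of a path from [v] to [w0] leads to a neighbour of [v]. *)
  have [_ /(_ (inl v) (inr w0))/connectP[[|[u|w] s] //= /andP[vw _] _]] := conE.
  by exists w.
have char0 n : (n%:R == 0 :> Cfield) = (n == 0)%N.
  exact: (@Num.Theory.pnatr_eq0 (Rdefinitions.R)[i] n).
pose br := @block_br Cfield Vb Wb E.
pose B := @block Cfield Vb Wb E.
have bil : bilinear_br br by apply: block_br_bilinear.
have dirB : directv (\sum_p B p)%VS by apply: block_direct.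
have sumB : (\sum_p B p = fullv)%VS by apply: block_total.
have nzB p : B p != 0%VS by apply: block_neq0.
have brM v x y : y \in B (inl v) -> br x y = 0 by apply: block_br_inl.
have edgeB p w : act_edge E p w -> brsp br (B p) (B (inr w)) = B p.
  exact: brsp_block.
have nedgeB p w : ~~ act_edge E p w -> sub_br br (B p) (B (inr w)) 0%VS.
  exact: block_br_nedge.
have altB w x : x \in B (inr w) -> br x x = 0 by apply: block_br_alt.
have rib X : X != 0%VS -> sub_br br X fullv X -> exists p, (B p <= X)%VS.
  exact: right_ideal_block.
(* The dimension is read off from [br]; the ideal is supplied by [block_Ispace]. *)
eexists _, br, _; split; first exact: bil.
split; first exact: block_br_leibniz.
split; first exact: (block_Ispace bil sumB brM edgeB nedgeB altB nisoE).
split.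
  exact: (block_semisimple bil dirB sumB nzB brM edgeB nedgeB altB rib nisoE).
split.
  exact: (block_indecomposable bil dirB sumB nzB brM edgeB nedgeB rib conE).
split; last by move=> m n g Ik; apply: decomp_bip_iso.
exists #|Wb|, #|Vb|, (fun i => B (inr (enum_val i))),
  (fun k => B (inl (enum_val k))).
exact: (block_decomposition bil dirB sumB nzB brM edgeB nedgeB altB rib).
Qed.
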